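(* Let $\mathcal{S}$ be a PTRS that is orthogonal and spare. Then $\mathcal{S}$ is fAST on basic terms if and only if $\mathcal{S}$ is iAST on basic terms, and $\mathcal{S}$ is fPAST on basic terms if and only if $\mathcal{S}$ is iPAST on basic terms.
   Context: Terms are built over a signature $\Sigma$ and variables $\mathcal{V}$. A finite multi-distribution $\mu$ on a nonempty set $A$ is a finite multiset of pairs $(p:a)$ with $0<p\le 1$, $a\in A$, $\sum_{(p:a)\in\mu}p=1$; $\operatorname{Supp}(\mu)$ is the multiset of the $a$'s; $p\cdot\mu=\{(pq:a)\mid(q:a)\in\mu\}$. A probabilistic rewrite rule is $\ell\to\mu$ with $\ell$ a non-variable term, $\mu$ a finite multi-distribution on terms, all variables of each $r\in\operatorname{Supp}(\mu)$ occurring in $\ell$. A PTRS is a (possibly infinite) set $\mathcal{S}$ of such rules. $s\to_{\mathcal{S}}\{p_1:t_1,\dots,p_k:t_k\}$ if there are a position $\pi$, a rule $\ell\to\{p_1:r_1,\dots,p_k:r_k\}\in\mathcal{S}$, a substitution $\sigma$ with $s|_\pi=\ell\sigma$ and $t_j=s[r_j\sigma]_\pi$; the step is innermost if all proper subterms of $\ell\sigma$ are normal forms w.r.t. $\mathcal{S}$. The lifting $\rightrightarrows$ of a relation $\to$ from terms to multi-distributions is the smallest relation on finite multi-distributions with: $\{1:t\}\rightrightarrows\{1:t\}$ if $t$ is a normal form w.r.t. $\to$; $\{1:t\}\rightrightarrows\mu$ if $t\to\mu$; and if $\mu_j\rightrightarrows\nu_j$, $0<p_j\le1$, $\sum_jp_j=1$,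 then $\bigcup_jp_j\cdot\mu_j\rightrightarrows\bigcup_jp_j\cdot\nu_j$; write $\rightrightarrows_{\mathcal{S}}$ for the lifting of $\to_{\mathcal{S}}$. $|\mu|_{\mathcal{S}}$ is the total probability in $\mu$ of terms that are normal forms w.r.t. $\mathcal{S}$; an infinite sequence $(\mu_n)_n$ converges with probability $\lim_n|\mu_n|_{\mathcal{S}}$ and has expected derivation length $\sum_{n=0}^\infty(1-|\mu_n|_{\mathcal{S}})$. The signature splits into defined symbols $\Sigma_D=\{\operatorname{root}(\ell)\mid\ell\to\mu\in\mathcal{S}\}$ and constructors $\Sigma_C=\Sigma\setminus\Sigma_D$. A term is basic if it has the form $f(t_1,\dots,t_n)$ with $f\in\Sigma_D$ and each $t_i$ a term over $\Sigma_C$ and $\mathcal{V}$. $\mathcal{S}$ is fAST (resp. iAST) on basic terms if every infinite sequence for the lifting of full (resp. innermost) rewriting with $\mathcal{S}$ starting with $\{1:t\}$ for a basic term $t$ converges with probability $1$; fPAST/iPAST on basic terms analogously with finite expected derivation length. A step $\ell\sigma\to_{\mathcal{S}}\mu\sigma$ with rule $\ell\to\mu$ (performed at any position of a term) is spare if $\sigma(x)$ is a normal form w.r.t. $\mathcal{S}$ for every variable $x$ occurring more than once in some $r\in\operatorname{Supp}(\mu)$; a $\rightrightarrows_{\mathcal{S}}$-sequence is spare if all its $\to_{\mathcal{S}}$-steps are spare; $\mathcal{S}$ is spare if every $\rightrightarrows_{\mathcal{S}}$-sequence starting with $\{1:t\}$ for a basic term $t$ is spare. $\mathcal{S}$ is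 orthogonal if it is left-linear (no variable occurs twice in a left-hand side) and non-overlapping (no two rules, variables renamed apart, have a non-variable subterm $\ell_1|_\pi$ of one left-hand side unifiable with the other left-hand side $\ell_2$, where $\pi\neq\varepsilon$ is required if both are the same rule). *)

(* Defs.v *)
From Stdlib Require List.
From HB Require Import structures.
From mathcomp Require Import all_boot all_order all_algebra.
From mathcomp Require Import all_classical all_reals all_analysis.

Set Implicit Arguments.
Unset Strict Implicit.
Unset Printing Implicit Defensive.

Import Order.TTheory GRing.Theory Num.Theory.
Import numFieldNormedType.Exports.

Local Open Scope classical_set_scope.
Local Open Scope ring_scope.

Record signature := Signature { symbol :> Type; arity : symbol -> nat }.

Inductive term (F : signature) (V : Type) : Type :=
| Var of V
| App (f : F) of ('I_(arity f) -> term F V).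

Arguments Var {F V}.
Arguments App {F V}.

HB.instance Definition _ (F : signature) (V : Type) := gen_eqMixin (term F V).

Section Terms.
Variables (F : signature) (V : eqType).
Implicit Types (t u : term F V) (pi : seq nat).

Definition is_var t := if t is Var _ then true else false.

(* The variable occurrences of a term, with multiplicity, from left to right. *)
Fixpoint vars t : seq V :=
  match t with
  | Var x => [:: x]
  | App f ts => flatten [seq vars (ts i) | i <- enum 'I_(arity f)]
  end.

Fixpoint subst (sigma : V -> term F V) t : term F V :=
  match t with
  | Var x => sigma x
  | App f ts => App f (fun i => subst sigma (ts i))
  end.

Definition rename (rho : V -> V) := subst (fun x => Var (rho x)).

(* [subterm t pi] is t|_pi, or None if pi is not a position of t; arguments
   are numbered from 0. *)
Fixpoint subterm t pi : option (term F V) :=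
  match pi, t with
  | [::], _ => Some t
  | i :: pi', App f ts =>
      if (insub i : option 'I_(arity f)) is Some j then subterm (ts j) pi'
      else None
  | _ :: _, Var _ => None
  end.

(* [replace t pi u] is t[u]_pi (only meaningful if pi is a position of t). *)
Fixpoint replace t pi u : term F V :=
  match pi, t with
  | [::], _ => u
  | i :: pi', App f ts =>
      App f (fun j => if nat_of_ord j == i then replace (ts j) pi' u else ts j)
  | _ :: _, Var _ => t
  end.

End Terms.

(* Finite multisets of pairs (p : a) are represented by sequences, read up to
   [perm_eq]; [is_mdist] singles out the finite multi-distributions. *)
Definition mdist (R : realType) (A : Type) := seq (R * A).

Section MultiDistributions.
Variables (R : realType) (A : Type).
Implicit Types mu : mdist R A.

Definition is_mdist mu : Prop :=
  all (fun q => 0 < q.1 <= 1) mu /\ \sum_(q <- mu) q.1 = 1.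

Definition Supp mu : seq A := [seq q.2 | q <- mu].

Definition scale (p : R) mu : mdist R A := [seq (p * q.1, q.2) | q <- mu].

(* The union of the p_j . mu_j for j < k. *)
Definition mix (k : nat) (p : 'I_k -> R) (mu : 'I_k -> mdist R A) : mdist R A :=
  flatten [seq scale (p j) (mu j) | j <- enum 'I_k].

Definition normal_form (step : A -> mdist R A -> Prop) (a : A) : Prop :=
  ~ exists mu, step a mu.

End MultiDistributions.

Section Lifting.
Variables (R : realType) (A : eqType).

(* [lift_perm] only identifies the sequences that denote the same multiset. *)
Inductive lifting (step : A -> mdist R A -> Prop) :
    mdist R A -> mdist R A -> Prop :=
| lift_nf a : normal_form step a -> lifting step [:: (1, a)] [:: (1, a)]
| lift_step a mu : step a mu -> lifting step [:: (1, a)] mu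
| lift_mix k (p : 'I_k -> R) (mu nu : 'I_k -> mdist R A) :
    (forall j, lifting step (mu j) (nu j)) ->
    (forall j, 0 < p j <= 1) -> \sum_(j < k) p j = 1 ->
    lifting step (mix p mu) (mix p nu)
| lift_perm mu mu' nu nu' :
    perm_eq mu mu' -> perm_eq nu nu' -> lifting step mu nu -> lifting step mu' nu'.

Definition unlabel (L : Type) (lstep : L -> A -> mdist R A -> Prop) :
    A -> mdist R A -> Prop :=
  fun a mu => exists l, lstep l a mu.

(* The lifting of a relation whose steps carry labels; the sequence collects
   the labels of all the steps used in the derivation, so that [lifting] is what
   remains when these are forgotten (see [lifting_unlabelP]). It is needed to
   speak about the steps of a sequence, which cannot be read off from the
   multi-distributions alone. *)
Inductive llifting (L : Type) (lstep : L -> A -> mdist R A -> Prop) :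
    seq L -> mdist R A -> mdist R A -> Prop :=
| llift_nf a :
    normal_form (unlabel lstep) a ->
    llifting lstep [::] [:: (1, a)] [:: (1, a)]
| llift_step l a mu : lstep l a mu -> llifting lstep [:: l] [:: (1, a)] mu
| llift_mix k (p : 'I_k -> R) (ls : 'I_k -> seq L) (mu nu : 'I_k -> mdist R A) :
    (forall j, llifting lstep (ls j) (mu j) (nu j)) ->
    (forall j, 0 < p j <= 1) -> \sum_(j < k) p j = 1 ->
    llifting lstep (flatten [seq ls j | j <- enum 'I_k]) (mix p mu) (mix p nu)
| llift_perm ls mu mu' nu nu' :
    perm_eq mu mu' -> perm_eq nu nu' ->
    llifting lstep ls mu nu -> llifting lstep ls mu' nu'.

Lemma lifting_unlabelP (L : Type) (lstep : L -> A -> mdist R A -> Prop) mu nu :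
  lifting (unlabel lstep) mu nu <-> exists ls, llifting lstep ls mu nu.
Proof.
split=> [|[ls]].
- elim=> {mu nu} [a nfa|a mu [l st]|k p mu nu _ IH p01 p1|mu mu' nu nu' pm pn _].
  + by exists [::]; apply: llift_nf.
  + by exists [:: l]; apply: llift_step.
  + have [ls Hls] := choice IH.
    by exists (flatten [seq ls j | j <- enum 'I_k]); apply: llift_mix.
  + by case=> ls H; exists ls; apply: llift_perm pm pn H.
- elim=> {ls mu nu} [a nfa|l a mu st|k p ls mu nu _ IH p01 p1
                    |ls mu mu' nu nu' pm pn _ IH].
  + exact: lift_nf.
  + by apply: lift_step; exists l.
  + exact: lift_mix.
  + exact: lift_perm pm pn IH.
Qed.

End Lifting.

Record rule (R : realType) (F : signature) (V : Type) := Rule {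
  lhs : term F V;
  rhs : mdist R (term F V) }.

(* A rewrite step is labelled by its position, its rule and its substitution. *)
Record redex (R : realType) (F : signature) (V : Type) := Redex {
  rpos : seq nat;
  rrule : rule R F V;
  rsubst : V -> term F V }.

Section Rewriting.
Variables (R : realType) (F : signature) (V : eqType).
Implicit Types (S : set (rule R F V)) (t s : term F V).
Implicit Types (mu : nat -> mdist R (term F V)).

Definition wf_rule (r : rule R F V) : Prop :=
  [/\ ~~ is_var (lhs r), is_mdist (rhs r)
    & forall u, u \in Supp (rhs r) -> {subset vars u <= vars (lhs r)}].

Definition is_ptrs S : Prop := forall r, S r -> wf_rule r.

(* Rules whose right-hand sides are permutations of each other denote the same
   rule, as right-hand sides are multisets. *)
Definition same_rule (r1 r2 : rule R F V) : Prop :=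
  lhs r1 = lhs r2 /\ perm_eq (rhs r1) (rhs r2).

Definition lfull S (l : redex R F V) s (nu : mdist R (term F V)) : Prop :=
  [/\ S (rrule l),
      subterm s (rpos l) = Some (subst (rsubst l) (lhs (rrule l)))
    & nu = [seq (q.1, replace s (rpos l) (subst (rsubst l) q.2))
           | q <- rhs (rrule l)]].

Definition full S : term F V -> mdist R (term F V) -> Prop :=
  unlabel (lfull S).

Definition nf S t : Prop := normal_form (full S) t.

Definition innermost_redex S (l : redex R F V) : Prop :=
  forall pi u, pi <> [::] ->
    subterm (subst (rsubst l) (lhs (rrule l))) pi = Some u -> nf S u.

Definition innermost S s (nu : mdist R (term F V)) : Prop :=
  exists l, innermost_redex S l /\ lfull S l s nu.

Definition nf_mass S (nu : mdist R (term F V)) : R :=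
  \sum_(q <- nu | `[< nf S q.2 >]) q.1.

Definition converges_with_prob S mu (p : R) : Prop :=
  nf_mass S (mu n) @[n --> \oo] --> p.

Definition edl S mu : \bar R :=
  (\sum_(0 <= n <oo) (1 - nf_mass S (mu n))%:E)%E.

Definition defined_symbol S (f : F) : Prop :=
  exists2 r, S r & exists ts, lhs r = App f ts.

Fixpoint constructor_term S t : Prop :=
  match t with
  | Var _ => True
  | App f ts => ~ defined_symbol S f /\ forall i, constructor_term S (ts i)
  end.

Definition basic S t : Prop :=
  exists f ts, [/\ t = App f ts, defined_symbol S f
                 & forall i, constructor_term S (ts i)].

Definition lift_seq (step : term F V -> mdist R (term F V) -> Prop) t mu : Prop :=
  mu 0%N = [:: (1, t)] /\ forall n, lifting step (mu n) (mu n.+1).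

Definition AST_on_basic S (step : term F V -> mdist R (term F V) -> Prop) : Prop :=
  forall t mu, basic S t -> lift_seq step t mu -> converges_with_prob S mu 1.

Definition PAST_on_basic S (step : term F V -> mdist R (term F V) -> Prop) : Prop :=
  forall t mu, basic S t -> lift_seq step t mu -> (edl S mu < +oo)%E.

Definition fAST_on_basic S := AST_on_basic S (full S).
Definition iAST_on_basic S := AST_on_basic S (innermost S).
Definition fPAST_on_basic S := PAST_on_basic S (full S).
Definition iPAST_on_basic S := PAST_on_basic S (innermost S).

Definition spare_redex S (l : redex R F V) : Prop :=
  forall u x, u \in Supp (rhs (rrule l)) -> (1 < count_mem x (vars u))%N ->
    nf S (rsubst l x).

(* Sequences of N steps, for every N; an infinite sequence is spare iff all its
   finite prefixes are. *)
Definition spare_ptrs S : Prop :=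
  forall t mu (ls : nat -> seq (redex R F V)) (N : nat),
    basic S t -> mu 0%N = [:: (1, t)] ->
    (forall n, (n < N)%N -> llifting (lfull S) (ls n) (mu n) (mu n.+1)) ->
    forall n, (n < N)%N -> List.Forall (spare_redex S) (ls n).

Definition left_linear S : Prop := forall r, S r -> uniq (vars (lhs r)).

Definition unifiable t s : Prop := exists sigma, subst sigma t = subst sigma s.

(* [rho] renames the variables of the second rule apart from the first one. *)
Definition overlap (r1 r2 : rule R F V) : Prop :=
  exists pi u rho,
    [/\ subterm (lhs r1) pi = Some u,
        ~~ is_var u,
        same_rule r1 r2 -> pi <> [::],
        {in vars (lhs r2) &, injective rho}
          /\ ~~ has (mem (vars (lhs r1))) (vars (rename rho (lhs r2)))
      & unifiable u (rename rho (lhs r2))].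

Definition non_overlapping S : Prop :=
  forall r1 r2, S r1 -> S r2 -> ~ overlap r1 r2.

Definition orthogonal_ptrs S : Prop := left_linear S /\ non_overlapping S.

End Rewriting.

(* Main.v *)
(** Fix a choice of one innermost step for every term that is not a normal form,
    and let [C_n t] be the probability that following it for [n] steps from [t]
    ends in a normal form. For a reachable term [t], a full step [t -> nu] and
    an innermost step [t -> nu'], the expectation of [C_n] under [nu'] is at
    most that under [nu], by induction on [n]: orthogonality makes the two steps
    commute, and by spareness the full step leaves at most one residual of the
    innermost redex, since that redex lies below a variable that is not
    instantiated by a normal form. If the redex is erased, only the full step
    gains, as [C_n <= C_(n+1)]. Hence after [n] steps every full rewrite
    sequence from a basic term has at least the normal form mass [C_n t] of one fixed
    innermost sequence, which settles both termination and expected length. *)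
Require Import Defs.
From mathcomp Require Import all_boot all_order all_algebra.
From mathcomp Require Import all_classical all_reals all_analysis.

(* Again, as mathcomp-analysis has an mdist of its own. *)
Import Defs.

Set Implicit Arguments.
Unset Strict Implicit.
Unset Printing Implicit Defensive.

Import Order.TTheory GRing.Theory Num.Theory.
Import numFieldNormedType.Exports.

Local Open Scope classical_set_scope.
Local Open Scope ring_scope.

(** * Positions, replacement and substitution in terms, and renaming apart *)

Section Positions.
Variables (F : signature) (V : eqType).
Implicit Types (t u v w : term F V) (p q : seq nat) (sigma : V -> term F V).

Lemma subterm_nil t : subterm t [::] = Some t. Proof. by case: t. Qed.

Lemma replace_nil t v : replace t [::] v = v. Proof. by case: t. Qed.

Lemma subterm_ord f (ts : 'I_(arity f) -> term F V) (j : 'I_(arity f)) p :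
  subterm (App f ts) ((j : nat) :: p) = subterm (ts j) p.
Proof. by rewrite /= valK. Qed.

Lemma subterm_AppP f (ts : 'I_(arity f) -> term F V) i p u :
  subterm (App f ts) (i :: p) = Some u ->
  exists2 j : 'I_(arity f), i = j & subterm (ts j) p = Some u.
Proof.
move=> /=; case E: insub => [j|//] st; exists j => //.
by have := insubK 'I_(arity f) i; rewrite E.
Qed.

Lemma subterm_consP t i p u : subterm t (i :: p) = Some u ->
  exists f ts (j : 'I_(arity f)),
    [/\ t = App f ts, i = j & subterm (ts j) p = Some u].
Proof. by case: t => // f ts /subterm_AppP[j ij st]; exists f, ts, j. Qed.

Lemma subterm_cat t p q u :
  subterm t p = Some u -> subterm t (p ++ q) = subterm u q.
Proof.
elim: p t => [|i p IH] t; first by rewrite subterm_nil => -[->].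
by case/subterm_consP=> f [ts [j [-> -> /IH]]]; rewrite cat_cons subterm_ord.
Qed.

Lemma subterm_replace t p u v :
  subterm t p = Some u -> subterm (replace t p v) p = Some v.
Proof.
elim: p t => [|i p IH] t; first by rewrite replace_nil !subterm_nil.
case/subterm_consP=> f [ts [j [-> -> /IH]]].
by rewrite [replace _ _ _]/= subterm_ord eqxx.
Qed.

Lemma replace_replace t p v w : replace (replace t p v) p w = replace t p w.
Proof.
elim: p t => [|i p IH] [x|f ts] //=; rewrite ?replace_nil //.
by congr App; apply/funext => k; case: eqP => // _; apply: IH.
Qed.

Lemma replace_cat t p q u v :
  subterm t p = Some u -> replace t (p ++ q) v = replace t p (replace u q v).
Proof.
elim: p t => [|i p IH] t.
  by rewrite subterm_nil => -[->]; rewrite ?replace_nil.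
case/subterm_consP=> f [ts [j [-> -> st]]] /=; congr App; apply/funext => k.
by case: eqP => // /val_inj ->; apply: IH.
Qed.

Definition parallel p q := ~~ prefix p q && ~~ prefix q p.

Lemma parallelC p q : parallel p q = parallel q p.
Proof. by rewrite /parallel andbC. Qed.

Lemma parallel0s q : parallel [::] q = false.
Proof. by rewrite /parallel prefix0s. Qed.

Lemma parallels0 p : parallel p [::] = false.
Proof. by rewrite parallelC parallel0s. Qed.

Lemma parallel_cons i j p q :
  parallel (i :: p) (j :: q) = ((i == j) ==> parallel p q).
Proof. by rewrite /parallel /= [j == i]eq_sym; case: eqP. Qed.

Lemma subterm_replace_parallel t p q v :
  parallel p q -> subterm (replace t p v) q = subterm t q.
Proof.
elim: p q t => [|i p IH] [|j q] [x|f ts]; rewrite ?parallel0s ?parallels0 //.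
rewrite parallel_cons /=; case E: insub => [k|//].
have := insubK 'I_(arity f) j; rewrite E /= => ->.
by rewrite [i == j]eq_sym; case: eqP => //= _ /IH.
Qed.

Lemma replace_parallel t p q v w : parallel p q ->
  replace (replace t p v) q w = replace (replace t q w) p v.
Proof.
elim: p q t => [|i p IH] [|j q] [x|f ts]; rewrite ?parallel0s ?parallels0 //.
rewrite parallel_cons /= => pq; congr App; apply/funext => k.
case: (eqVneq (k : nat) j) => [kj|kj]; case: (eqVneq (k : nat) i) => [ki|ki] //.
by apply: IH; move: pq; rewrite -kj -ki eqxx.
Qed.

Lemma subterm_subst sigma t p u : subterm t p = Some u ->
  subterm (subst sigma t) p = Some (subst sigma u).
Proof.
elim: p t => [|i p IH] t; first by rewrite !subterm_nil => -[->].
case/subterm_consP=> f [ts [j [-> -> /IH]]].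
by rewrite [subst _ (App _ _)]/= subterm_ord.
Qed.

(** Separates a redex that overlaps the pattern [t] from one inside the substituted part, at or
    below a variable of [t]. *)
Lemma subterm_substP sigma t p v : subterm (subst sigma t) p = Some v ->
  (exists u, [/\ subterm t p = Some u, ~~ is_var u & v = subst sigma u]) \/
  (exists x p1 p2, [/\ p = p1 ++ p2, subterm t p1 = Some (Var x)
                     & subterm (sigma x) p2 = Some v]).
Proof.
elim: t p => [x|f ts IH] p /=; first by move=> st; right; exists x, [::], p.
case: p => [|i p] /=; first by case=> <-; left; exists (App f ts).
case E: insub => [j|//] /IH[[u [st nu ->]]|[x [p1 [p2 [-> st1 st2]]]]].
  by left; exists u.
by right; exists x, (i :: p1), p2; split=> //=; rewrite E.
Qed.

Lemma var_subterm t x : x \in vars t -> exists p, subterm t p = Some (Var x).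
Proof.
elim: t => [y|f ts IH] /=; first by rewrite inE => /eqP ->; exists [::].
case/flatten_mapP => i _ /IH[p st]; exists ((i : nat) :: p).
exact: etrans (subterm_ord ts i p) st.
Qed.

Lemma subterm_vars t p u : subterm t p = Some u -> {subset vars u <= vars t}.
Proof.
elim: p t => [|i p IH] t; first by rewrite subterm_nil => -[->].
case/subterm_consP=> f [ts [j [-> _ /IH sub]]] x xu.
by apply/flatten_mapP; exists j; rewrite ?mem_enum ?sub.
Qed.

Lemma eq_subst sigma tau t :
  {in vars t, sigma =1 tau} -> subst sigma t = subst tau t.
Proof.
elim: t => [x|f ts IH] /= eq_st; first by apply: eq_st; rewrite inE.
congr App; apply/funext => i; apply: IH => x xi; apply: eq_st.
by apply/flatten_mapP; exists i; rewrite ?mem_enum.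
Qed.

Lemma subst_inj_vars sigma tau t :
  subst sigma t = subst tau t -> {in vars t, sigma =1 tau}.
Proof.
move=> eq_t x /var_subterm[p st]; have := subterm_subst sigma st.
by rewrite eq_t (subterm_subst tau st) => -[].
Qed.

Lemma subst_comp sigma tau t :
  subst sigma (subst tau t) = subst (fun x => subst sigma (tau x)) t.
Proof. by elim: t => //= f ts IH; congr App; apply/funext. Qed.

Definition upd sigma x v : V -> term F V :=
  fun y => if y == x then v else sigma y.

Lemma subst_upd_notin sigma x v t :
  x \notin vars t -> subst (upd sigma x v) t = subst sigma t.
Proof.
move=> xt; apply: eq_subst => y yt; rewrite /upd.
by case: eqP yt xt => // -> ->.
Qed.

Lemma subst_upd_linear sigma x v t p :
  (count_mem x (vars t) <= 1)%N -> subterm t p = Some (Var x) ->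
  subst (upd sigma x v) t = replace (subst sigma t) p v.
Proof.
elim: p t => [|i p IH] t lin.
  by rewrite subterm_nil replace_nil => -[->] /=; rewrite /upd eqxx.
case/subterm_consP=> f [ts [j [tE -> st]]]; rewrite {t}tE /= in lin *.
have xj : (0 < count_mem x (vars (ts j)))%N.
  by rewrite -has_count has_pred1; apply: (subterm_vars st); rewrite inE.
move: lin; rewrite count_flatten -map_comp sumnE big_map big_enum /=.
rewrite (bigD1 j) //= => lin.
congr App; apply/funext => k; case: eqVneq => [/val_inj ->|kj].
  by apply: IH => //; apply: leq_trans (leq_addr _ _) lin.
(* Argument [j] already uses up the single allowed occurrence. *)
apply: subst_upd_notin; rewrite -has_pred1 has_count -leqNgt.
move: lin; rewrite (bigD1 k) //= => lin.
rewrite -(leq_add2l 1); apply: leq_trans lin.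
by apply: leq_add => //; apply: leq_addr.
Qed.

Lemma fresh_renaming (V_infinite : infinite_set [set: V]) (s1 s2 : seq V) :
  exists rho rho' : V -> V,
    {in s2, cancel rho rho'} /\ {in s2, forall x, rho x \notin s1}.
Proof.
elim: s2 => [|y s [rho [rho' [canK avoid]]]]; first by exists id, id.
have [ys|ys] := boolP (y \in s).
  exists rho, rho'; split=> x; rewrite inE => /predU1P[->|];
    by [apply: canK | apply: avoid].
have [z zF] : exists z, z \notin s1 ++ map rho s.
  apply: contrapT => /forallNP noz; apply: V_infinite.
  suff -> : [set: V] = [set` s1 ++ map rho s] by apply: finite_seq.
  by apply/seteqP; split=> // x _ /=; apply/negPn/negP/noz.
move: zF; rewrite mem_cat negb_or => /andP[z1 zs].
exists (fun x => if x == y then z else rho x),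
       (fun x => if x == z then y else rho' x); split=> x; rewrite inE.
- case: eqP => [-> _|_ /= xs]; first by rewrite eqxx.
  by case: eqP zs => [<-|_ _]; rewrite ?map_f //; apply: canK.
- by case: eqP => //= _; apply: avoid.
Qed.

(** Disjointness of the variables lets one substitution act as [sigma1] on [l1] and as [sigma2],
    read back through [rho'], on the renamed [l2]. *)
Lemma unifiable_apart rho rho' sigma1 sigma2 (u l1 l2 : term F V) :
  {subset vars u <= vars l1} -> {in vars l2, cancel rho rho'} ->
  {in vars l2, forall x, rho x \notin vars l1} ->
  subst sigma1 u = subst sigma2 l2 -> unifiable u (rename rho l2).
Proof.
move=> sub canK avoid eq12.
exists (fun x => if x \in vars l1 then sigma1 x else sigma2 (rho' x)).
rewrite /rename subst_comp /=.
rewrite (@eq_subst _ sigma1 u) => [|x /sub -> //].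
by rewrite eq12; apply: eq_subst => x xl /=; rewrite (negPf (avoid _ xl)) canK.
Qed.

End Positions.

(** * Finite expectations and their behaviour under liftings *)

Section Expectations.
Variables (R : realType) (A : eqType).
Implicit Types (mu nu : mdist R A) (f g : A -> R).
Implicit Types step : A -> mdist R A -> Prop.

Definition expect f mu : R := \sum_(q <- mu) q.1 * f q.2.

Lemma expect_scale f c mu : expect f (scale c mu) = c * expect f mu.
Proof.
by rewrite /expect big_map mulr_sumr; apply: eq_bigr => q _; rewrite mulrA.
Qed.

Lemma expect_flatten f (I : Type) (s : seq I) (mu : I -> mdist R A) :
  expect f (flatten [seq mu i | i <- s]) = \sum_(i <- s) expect f (mu i).
Proof. by rewrite /expect big_flatten /= big_map. Qed.

Lemma expect_mix f k (p : 'I_k -> R) (mu : 'I_k -> mdist R A) :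
  expect f (mix p mu) = \sum_(j < k) p j * expect f (mu j).
Proof.
by rewrite expect_flatten big_enum; apply: eq_bigr => j _; rewrite expect_scale.
Qed.

Lemma expect_perm f mu nu : perm_eq mu nu -> expect f mu = expect f nu.
Proof. exact: perm_big. Qed.

Lemma expect_map f (h : A -> A) mu :
  expect f [seq (q.1, h q.2) | q <- mu] = expect (f \o h) mu.
Proof. by rewrite /expect big_map. Qed.

Lemma expect_exchange (f : A -> A -> R) mu nu :
  expect (fun b => expect (fun a => f a b) mu) nu =
  expect (fun a => expect (f a) nu) mu.
Proof.
rewrite /expect; under eq_bigr do rewrite mulr_sumr.
rewrite exchange_big; apply: eq_bigr => p _; rewrite mulr_sumr.
by apply: eq_bigr => q _; rewrite mulrCA.
Qed.

Lemma expect_cst c mu : is_mdist mu -> expect (fun=> c) mu = c.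
Proof. by case=> _ sum1; rewrite /expect -mulr_suml sum1 mul1r. Qed.

Lemma expect_dirac f a : expect f [:: (1, a)] = f a.
Proof. by rewrite /expect big_seq1 mul1r. Qed.

Lemma expect_le f g mu : is_mdist mu ->
  {in Supp mu, forall a, f a <= g a} -> expect f mu <= expect g mu.
Proof.
case=> /allP pos _ fg; rewrite /expect big_seq [leRHS]big_seq.
apply: ler_sum => q qmu; apply: ler_wpM2l; last by apply: fg; apply: map_f.
by case/andP: (pos q qmu) => /ltW.
Qed.

Lemma Supp_mix k (p : 'I_k -> R) (mu : 'I_k -> mdist R A) a :
  reflect (exists j, a \in Supp (mu j)) (a \in Supp (mix p mu)).
Proof.
have -> : Supp (mix p mu) = flatten [seq Supp (mu j) | j <- enum 'I_k].
  rewrite /Supp /mix map_flatten -map_comp; congr flatten; apply: eq_map => j.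
  by rewrite /= /scale -map_comp.
apply: (iffP flatten_mapP) => [[j _]|[j]]; exists j => //.
by rewrite mem_enum.
Qed.

Lemma perm_Supp mu nu : perm_eq mu nu -> Supp mu =i Supp nu.
Proof. by move=> mn; apply/perm_mem/perm_map. Qed.

Lemma is_mdist_dirac (a : A) : is_mdist [:: (1 : R, a)].
Proof. by split; rewrite /= ?ltr01 ?lexx // big_seq1. Qed.

Lemma is_mdist_mix k (p : 'I_k -> R) (mu : 'I_k -> mdist R A) :
  (forall j, is_mdist (mu j)) -> (forall j, 0 < p j <= 1) ->
  \sum_(j < k) p j = 1 -> is_mdist (mix p mu).
Proof.
move=> mu_mdist p01 p1; split.
  apply/allP => q /flatten_mapP[j _] /mapP[q' q'mu -> /=].
  have [/allP/(_ q' q'mu)/andP[q0 q1] _] := mu_mdist j.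
  have /andP[pj0 pj1] := p01 j.
  by rewrite mulr_gt0 //= mulr_ile1 // ltW.
rewrite -[RHS]p1 big_flatten /= big_map big_enum; apply: eq_bigr => j _ /=.
by rewrite big_map -mulr_sumr; case: (mu_mdist j) => _ ->; rewrite mulr1.
Qed.

Lemma is_mdist_perm mu nu : perm_eq mu nu -> is_mdist mu -> is_mdist nu.
Proof.
by move=> mn [pos sum1]; split; rewrite -?(perm_all _ mn) -?(perm_big _ mn).
Qed.

Lemma lifting_mdist step mu nu :
  (forall a rho, step a rho -> is_mdist rho) ->
  lifting step mu nu -> is_mdist mu /\ is_mdist nu.
Proof.
move=> step_mdist.
elim=> {mu nu} [a _|a rho /step_mdist|k p mu nu _ IH p01 p1|].
- by split; apply: is_mdist_dirac.
- by split=> //; apply: is_mdist_dirac.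
- by split; apply: is_mdist_mix => // j; case: (IH j).
- move=> mu mu' nu nu' mm nn _ [mu_mdist nu_mdist].
  by split; [apply: is_mdist_perm mm _ | apply: is_mdist_perm nn _].
Qed.

Lemma lifting_Supp step (P : A -> Prop) mu nu :
  (forall a rho b, P a -> step a rho -> b \in Supp rho -> P b) ->
  lifting step mu nu -> {in Supp mu, forall a, P a} ->
  {in Supp nu, forall a, P a}.
Proof.
move=> closedP.
elim=> {mu nu} [//|a rho st Pa b|k p mu nu _ IH _ _ Pmu b /Supp_mix[j]|].
- by apply: closedP st; apply: Pa; rewrite inE.
- by apply: IH => a aj; apply: Pmu; apply/Supp_mix; exists j.
- move=> mu mu' nu nu' mm nn _ IH Pmu a; rewrite -(perm_Supp nn); apply: IH.
  by move=> b; rewrite (perm_Supp mm); apply: Pmu.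
Qed.

(** The one-step inequality survives mixing, as expectation is linear in the multi-distribution. Two
    functions are allowed because a step will lower the index of [nf_prob] by one. *)
Lemma lifting_expect_le step (P : A -> Prop) f g mu nu :
  (forall a, normal_form step a -> f a <= g a) ->
  (forall a rho, P a -> step a rho -> f a <= expect g rho) ->
  lifting step mu nu -> {in Supp mu, forall a, P a} ->
  expect f mu <= expect g nu.
Proof.
move=> fg_nf fg_step.
elim=> {mu nu} [a nfa _|a rho st Pa|k p mu nu _ IH p01 _ Pmu|].
- by rewrite !expect_dirac fg_nf.
- by rewrite expect_dirac; apply: fg_step => //; apply: Pa; rewrite inE.
- rewrite !expect_mix; apply: ler_sum => j _; apply: ler_wpM2l.
    by case/andP: (p01 j) => /ltW.
  by apply: IH => a aj; apply: Pmu; apply/Supp_mix; exists j.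
- move=> mu mu' nu nu' mm nn _ IH Pmu.
  rewrite -(expect_perm _ mm) -(expect_perm _ nn); apply: IH => a.
  by rewrite (perm_Supp mm); apply: Pmu.
Qed.

Lemma lifting_sub step step' mu nu :
  (forall a rho, step a rho -> step' a rho) ->
  (forall a, normal_form step a -> normal_form step' a) ->
  lifting step mu nu -> lifting step' mu nu.
Proof.
move=> sub nf_sub; elim=> {mu nu} [a /nf_sub|a rho /sub|k p mu nu _ IH|].
- exact: lift_nf.
- exact: lift_step.
- exact: lift_mix.
- by move=> mu mu' nu nu' mm nn _; apply: lift_perm.
Qed.

Lemma llifting_pointwise (L : Type) (lstep : L -> A -> mdist R A -> Prop)
    (ls : A -> seq L) (kappa : A -> mdist R A) mu :
  is_mdist mu -> (forall a, llifting lstep (ls a) [:: (1, a)] (kappa a)) ->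
  llifting lstep (flatten [seq ls q.2 | q <- mu]) mu
    (flatten [seq scale q.1 (kappa q.2) | q <- mu]).
Proof.
move=> [/allP pos sum1] steps; pose at_ := tnth (in_tuple mu).
have muE B (h : R * A -> B) : [seq h q | q <- mu] =
    [seq h (at_ j) | j <- enum 'I_(size mu)].
  by rewrite (map_comp h at_) map_tnth_enum.
have -> : flatten [seq ls q.2 | q <- mu] =
    flatten [seq ls (at_ j).2 | j <- enum 'I_(size mu)].
  by rewrite (muE _ (fun q => ls q.2)).
have -> : flatten [seq scale q.1 (kappa q.2) | q <- mu] =
    mix (fun j => (at_ j).1) (fun j => kappa (at_ j).2).
  by rewrite (muE _ (fun q => scale q.1 (kappa q.2))).
(* A multi-distribution is the mixture of its own Dirac entries, indexed by occurrence. *)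
have muD : mu = mix (fun j => (at_ j).1) (fun j => [:: (1, (at_ j).2)]).
  rewrite /mix /scale /= -(muE _ (fun q => [:: (q.1 * 1, q.2)])).
  by elim: (mu) => //= -[p a] s {1}->; rewrite mulr1.
rewrite [X in llifting _ _ X _]muD.
apply: (llift_mix (ls := fun j => ls (at_ j).2)) => [//|j|].
  by apply: pos; apply: mem_tnth.
by rewrite -sum1 [RHS]big_tnth.
Qed.

End Expectations.

(** * Rewrite steps, normal forms and innermost redexes *)

Section Rewriting.
Variables (R : realType) (F : signature) (V : eqType) (S : set (rule R F V)).
Implicit Types (s t u v : term F V) (l : redex R F V) (p : seq nat).
Implicit Types (mu nu : mdist R (term F V)).

Lemma lfull_subterm t p u l nu : subterm t p = Some u -> lfull S l u nu ->
  lfull S (Redex (p ++ rpos l) (rrule l) (rsubst l)) t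
    [seq (q.1, replace t p q.2) | q <- nu].
Proof.
move=> st [Sl sl ->]; split=> //=; first by rewrite (subterm_cat _ st).
by rewrite -map_comp; apply: eq_map => q /=; rewrite (replace_cat _ _ st).
Qed.

Lemma nf_subterm t p u : subterm t p = Some u -> nf S t -> nf S u.
Proof.
move=> st nft [nu [l /(lfull_subterm st) step]]; apply: nft.
by do 2!eexists; exact: step.
Qed.

Lemma lfull_root r sigma : S r ->
  lfull S (Redex [::] r sigma) (subst sigma (lhs r))
    [seq (q.1, subst sigma q.2) | q <- rhs r].
Proof.
move=> Sr; split; rewrite ?subterm_nil //=.
by apply: eq_map => q; rewrite replace_nil.
Qed.

Lemma redex_not_nf r sigma : S r -> ~ nf S (subst sigma (lhs r)).
Proof. by move=> /(lfull_root sigma) st; apply; do 2!eexists; exact: st. Qed.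

Lemma full_not_nf t nu : full S t nu -> ~ nf S t.
Proof. by move=> st; apply; exists nu. Qed.

Lemma innermost_full t nu : innermost S t nu -> full S t nu.
Proof. by case=> l [_ st]; exists l. Qed.

Section PTRS.
Hypothesis S_ptrs : is_ptrs S.

Lemma lfull_mdist l t nu : lfull S l t nu -> is_mdist nu.
Proof.
move=> [/S_ptrs[_ [pos sum1] _] _ ->]; split; first by rewrite all_map.
by rewrite big_map.
Qed.

Lemma full_mdist t nu : full S t nu -> is_mdist nu.
Proof. by case=> l; apply: lfull_mdist. Qed.

(** A reducible argument is handled by induction. If there is none, all proper subterms are normal,
    so the given step is at the root and already innermost. *)
Lemma innermost_exists t : ~ nf S t -> exists nu, innermost S t nu.
Proof.
elim: t => [x|f ts IH] /contrapT[nu [l st]].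
  case: st => Sl + _; case: (rpos l) => //= -[]; case: (S_ptrs Sl) => + _ _.
  by case: (lhs _).
have [[i nfi]|nfts] := pselect (exists i, ~ nf S (ts i)).
  have sti : subterm (App f ts) [:: (i : nat)] = Some (ts i).
    exact: etrans (subterm_ord ts i [::]) (subterm_nil _).
  have [rho [l' [inn /(lfull_subterm sti) sl]]] := IH i nfi.
  by eexists; eexists; split; last exact: sl.
have nf_proper p u : p <> [::] -> subterm (App f ts) p = Some u -> nf S u.
  case: p => // i p _ /subterm_AppP[j _ /nf_subterm]; apply.
  by apply: contrapT => nfi; apply: nfts; exists j.
exists nu, l; split=> // p u p0 sp; have [Sl sl _] := st.
have root_l : rpos l = [::].
  by apply: contrapT => l0; apply: redex_not_nf Sl (nf_proper _ _ l0 sl).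
move: sl; rewrite root_l subterm_nil => -[tE].
by apply: nf_proper p0 _; rewrite tE.
Qed.

(** * Local commutation of a full and an innermost step *)

Section Orthogonal.
Hypothesis V_infinite : infinite_set [set: V].
Hypothesis S_orthogonal : orthogonal_ptrs S.

(** With infinitely many variables [r2] can be renamed apart, and the common instance becomes a
    unifier; only the trivial overlap of a rule with itself is left. *)
Lemma overlap_root r1 r2 sigma1 sigma2 p u : S r1 -> S r2 ->
  subterm (lhs r1) p = Some u -> ~~ is_var u ->
  subst sigma1 u = subst sigma2 (lhs r2) -> p = [::] /\ same_rule r1 r2.
Proof.
move=> Sr1 Sr2 su nvar eq12; apply: contrapT => no.
have [rho [rho' [canK avoid]]] :=
  fresh_renaming V_infinite (vars (lhs r1)) (vars (lhs r2)).
have [_ /(_ r1 r2 Sr1 Sr2)] := S_orthogonal; apply.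
exists p, u, rho; split=> //.
- by move=> same p0; apply: no.
- split; first exact: can_in_inj canK.
  rewrite /rename; apply/hasPn => x.
  elim: (lhs r2) avoid => [y|f ts IH] avoid /=.
    by rewrite inE => /eqP ->; apply: avoid; rewrite inE.
  case/flatten_mapP => i _; apply: IH => y yi; apply: avoid.
  by apply/flatten_mapP; exists i; rewrite ?mem_enum.
- exact: unifiable_apart (subterm_vars su) canK avoid eq12.
Qed.

(* [w a b] is reached both by the full step and then the residual of the
   innermost one, and by the innermost step and then the residual of the full
   one; the full step may instead erase the innermost redex. *)
Definition joinable nu nu' : Prop :=
  exists rho rho' (c c' : term F V -> term F V)
    (w : term F V -> term F V -> term F V),
    [/\ is_mdist rho, is_mdist rho', nu = [seq (q.1, c q.2) | q <- rho]
      & nu' = [seq (q.1, c' q.2) | q <- rho']] /\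
    {in Supp rho', forall b, full S (c' b) [seq (q.1, w q.2 b) | q <- rho]} /\
    {in Supp rho, forall a, {in Supp rho', forall b, w a b = c a} \/
       innermost S (c a) [seq (q.1, w a q.2) | q <- rho']}.

(** Parallel steps are independent. An innermost redex at or below the full one is the same redex or
    lies inside the substitution. A full redex strictly below the innermost one cannot exist. *)
Lemma local_commute t l l' nu nu' :
  spare_redex S l -> innermost_redex S l' ->
  lfull S l t nu -> lfull S l' t nu' -> perm_eq nu nu' \/ joinable nu nu'.
Proof.
case: l l' => [p r sigma] [p' r' sigma'] spare inn.
move=> [/= Sr sr nuE] [/= Sr' sr' nu'E].
have [nvar r_mdist r_vars] := S_ptrs Sr.
have [_ r'_mdist _] := S_ptrs Sr'.
pose c a := replace t p (subst sigma a).
pose c' b := replace t p' (subst sigma' b).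
have [|/prefixP[pr p'E]|/andP[/prefixP[pr pE] not_pre]] :
  [\/ parallel p p', prefix p p' | prefix p' p && ~~ prefix p p'].
- rewrite /parallel; case: (prefix p p'); case: (prefix p' p) => //=;
    by [constructor 1 | constructor 2 | constructor 3].
- move=> par; right; exists (rhs r), (rhs r'), c, c'.
  exists (fun a b => replace (c a) p' (subst sigma' b)); split=> //; split.
    move=> b _; exists (Redex p r sigma); split=> //=.
      by rewrite subterm_replace_parallel // parallelC.
    by apply: eq_map => q; rewrite replace_parallel.
  move=> a _; right; exists (Redex p' r' sigma'); split=> //; split=> //=.
  by rewrite subterm_replace_parallel.
- subst p'; have := sr'; rewrite (subterm_cat _ sr).
  case/subterm_substP => [[u [su nu_ uE]]|[x [p1 [p2 [prE sx sx2]]]]].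
    (* The redexes coincide; the rules agree only up to the order of their right-hand sides, hence
       [perm_eq]. *)
    left; have [pr0 [lhsE rhsE]] := overlap_root Sr Sr' su nu_ (esym uE).
    move: su uE; rewrite pr0 subterm_nil => -[<-] uE.
    have eq_sigma : {in vars (lhs r), sigma =1 sigma'}.
      by apply: subst_inj_vars; rewrite -uE lhsE.
    rewrite nuE nu'E pr0 cats0.
    suff -> : [seq (q.1, replace t p (subst sigma q.2)) | q <- rhs r] =
        [seq (q.1, replace t p (subst sigma' q.2)) | q <- rhs r].
      exact: perm_map.
    apply/eq_in_map => q q_r; congr (_, replace _ _ _); apply: eq_subst => x xq.
    by apply: eq_sigma; apply: r_vars xq; apply: map_f.
  (* [sigma_ b] carries out the innermost step inside [sigma x]. By left-linearity the result is
     still an instance of [lhs r], so the outer step survives. *)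
  right; pose sigma_ b := upd sigma x (replace (sigma x) p2 (subst sigma' b)).
  have not_nfx : ~ nf S (sigma x).
    by move=> /(nf_subterm sx2); apply: redex_not_nf.
  exists (rhs r), (rhs r'), c, c'.
  exists (fun a b => replace t p (subst (sigma_ b) a)).
  split=> //; split=> [b _|a a_r].
    have c'E : c' b = replace t p (subst (sigma_ b) (lhs r)).
      rewrite /c' (replace_cat _ _ sr) prE.
      rewrite (replace_cat _ _ (subterm_subst _ sx)).
      rewrite [subst (sigma_ b) _](subst_upd_linear _ _ _ sx) //.
      have [/(_ r Sr) lin _] := S_orthogonal.
      by rewrite count_uniq_mem // leq_b1.
    exists (Redex p r (sigma_ b)); split=> //=.
      by rewrite c'E (subterm_replace _ sr).
    by apply: eq_map => q; rewrite c'E replace_replace.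
  (* As [sigma x] is reducible, spareness forbids a second occurrence of [x]: the inner redex is
     erased or has exactly one residual. *)
  have lin : (count_mem x (vars a) <= 1)%N.
    by rewrite leqNgt; apply/negP => /(spare _ _ a_r).
  have [/var_subterm[p3 sx3]|x_a] := boolP (x \in vars a); last first.
    by left=> b _; rewrite /sigma_ subst_upd_notin.
  right; exists (Redex (p ++ (p3 ++ p2)) r' sigma'); split=> //; split=> //=.
    rewrite (subterm_cat _ (subterm_replace _ sr)).
    by rewrite (subterm_cat _ (subterm_subst _ sx3)).
  apply: eq_map => q; rewrite (replace_cat _ _ (subterm_replace _ sr)).
  rewrite replace_replace (replace_cat _ _ (subterm_subst _ sx3)).
  by rewrite [subst (sigma_ _) _](subst_upd_linear _ _ _ sx3).
- have pr0 : pr <> [::].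
    by move=> pr0; rewrite pE pr0 cats0 prefix_refl in not_pre.
  move: sr; rewrite pE (subterm_cat _ sr') => /(inn _ _ pr0) nf_r.
  by case: (redex_not_nf Sr nf_r).
Qed.

(** Following single branches suits induction along steps, whereas [spare_ptrs] speaks of whole
    sequences; [reachable_run] links the two. *)
Inductive reachable : term F V -> Prop :=
| reachable_basic t : basic S t -> reachable t
| reachable_step t l nu u :
    reachable t -> lfull S l t nu -> u \in Supp nu -> reachable u.

(** All entries of [mu] must move at once: copies of [t] use [l], other reducible terms take any
    step, normal forms stay. The last clause encodes that [l] is among [ls]. *)
Lemma llifting_extend mu t l nu : is_mdist mu -> t \in Supp mu ->
  lfull S l t nu ->
  exists ls nu', [/\ llifting (lfull S) ls mu nu', {subset Supp nu <= Supp nu'}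
    & forall P : redex R F V -> Prop, List.Forall P ls -> P l].
Proof.
move=> mu_mdist /mapP[q0 q0mu tE] st.
have /choice[lk lkP] a : exists lk : seq (redex R F V) * mdist R (term F V),
    llifting (lfull S) lk.1 [:: (1, a)] lk.2 /\ (a = t -> lk = ([:: l], nu)).
  have [->|a_t] := pselect (a = t).
    by exists ([:: l], nu); split=> //; apply: llift_step.
  have [nfa|/contrapT[rho [l' st']]] := pselect (nf S a).
    by exists ([::], [:: (1, a)]); split=> //; apply: llift_nf.
  by exists ([:: l'], rho); split=> //; apply: llift_step.
have lkt : lk t = ([:: l], nu) by apply: (lkP t).2.
do 2!eexists; split.
- by apply: (llifting_pointwise (ls := fun a => (lk a).1)
               (kappa := fun a => (lk a).2) mu_mdist) => a; case: (lkP a).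
- move=> u /mapP[q q_nu ->]; apply/mapP; exists (q0.1 * q.1, q.2) => //.
  apply/flatten_mapP; exists q0 => //; apply/mapP; exists q => //.
  by rewrite -tE lkt.
- move=> P; elim: mu q0mu {mu_mdist} => //= q mu IH.
  have Forall_cat (s1 s2 : seq (redex R F V)) :
      List.Forall P (s1 ++ s2) -> List.Forall P s1 /\ List.Forall P s2.
    elim: s1 => [|x s1 IHs] /= HP; first by split=> //; constructor.
    by inversion_clear HP; case: IHs => // ? ?; split=> //; constructor.
  rewrite inE => /predU1P[<-|/IH{}IH] /Forall_cat[Pq Pmu]; last exact: IH.
  by move: Pq; rewrite -tE lkt => HP; inversion_clear HP.
Qed.

Lemma reachable_run t : reachable t ->
  exists t0 (mu : nat -> mdist R (term F V)) ls N,
  [/\ basic S t0, mu 0%N = [:: (1, t0)],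
      forall n, (n < N)%N -> llifting (lfull S) (ls n) (mu n) (mu n.+1),
      is_mdist (mu N) & t \in Supp (mu N)].
Proof.
elim=> {t} [t t_basic|t l nu u _ IH st u_nu].
  exists t, (fun=> [:: (1, t)]), (fun=> [::]), 0%N; split=> //.
    exact: is_mdist_dirac.
  by rewrite inE.
have [t0 [mu [ls [N [t0_basic mu0 run mdN tN]]]]] := IH.
have [lsN [nu' [stN sub _]]] := llifting_extend mdN tN st.
exists t0, (fun n => if (n <= N)%N then mu n else nu'),
  (fun n => if (n < N)%N then ls n else lsN), N.+1; split=> //.
- move=> n; rewrite ltnS => n_N; rewrite n_N.
  by case: ltngtP n_N => // [/run//|->].
- rewrite ltnn; suff : is_mdist (mu N) /\ is_mdist nu' by case.
  apply: (lifting_mdist (step := full S)) full_mdist _.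
  by apply/lifting_unlabelP; exists lsN.
- by rewrite ltnn; apply: sub.
Qed.

(** * Comparison of full sequences with one fixed innermost strategy *)

Section Spare.
Hypothesis S_spare : spare_ptrs S.

(** A run reaching [t] is extended by a step that uses [l]; spareness of the longer run covers its
    last step. *)
Lemma reachable_spare t l nu : reachable t -> lfull S l t nu -> spare_redex S l.
Proof.
move=> /reachable_run[t0 [mu [ls [N [t0_basic mu0 run mdN tN]]]]] st.
have [lsN [nu' [stN _]]] := llifting_extend mdN tN st; apply.
have := @S_spare t0 (fun n => if (n <= N)%N then mu n else nu')
  (fun n => if (n < N)%N then ls n else lsN) N.+1 t0_basic mu0.
move=> /(_ _ N (ltnSn N)); rewrite ltnn; apply=> n; rewrite ltnS => n_N.
by rewrite n_N; case: ltngtP n_N => // [/run//|->].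
Qed.

Variable istep : term F V -> mdist R (term F V).
Hypothesis istepP : forall t, ~ nf S t -> innermost S t (istep t).

(** This is [C_n], unfolded at the first step; for [n = 0] it is the indicator of normal forms. *)
Fixpoint nf_prob n t : R :=
  if `[< nf S t >] then 1
  else if n is n'.+1 then expect (nf_prob n') (istep t) else 0.

Lemma nf_prob_nf n t : nf S t -> nf_prob n t = 1.
Proof. by move=> nft; case: n => [|n] /=; rewrite asboolT. Qed.

Lemma nf_prob0 t : ~ nf S t -> nf_prob 0 t = 0.
Proof. by move=> nft; rewrite /= asboolF. Qed.

Lemma nf_probS n t : ~ nf S t -> nf_prob n.+1 t = expect (nf_prob n) (istep t).
Proof. by move=> nft; rewrite /= asboolF. Qed.

Lemma istep_mdist t : ~ nf S t -> is_mdist (istep t).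
Proof. by move=> /istepP/innermost_full/full_mdist. Qed.

Lemma nf_prob_ge0 n t : 0 <= nf_prob n t.
Proof.
elim: n t => [|n IH] t; have [nft|nft] := pselect (nf S t);
  rewrite ?(nf_prob_nf _ nft) ?(nf_prob0 nft) ?(nf_probS _ nft) //.
rewrite -(expect_cst 0 (istep_mdist nft)).
by apply: expect_le => [|a _]; [apply: istep_mdist | apply: IH].
Qed.

Lemma nf_prob_leS n t : nf_prob n t <= nf_prob n.+1 t.
Proof.
have [nft|nft] := pselect (nf S t); first by rewrite !nf_prob_nf.
elim: n t nft => [|n IH] t nft; first by rewrite nf_prob0 // nf_prob_ge0.
rewrite !nf_probS //; apply: expect_le => [|a _]; first exact: istep_mdist.
by have [nfa|/IH//] := pselect (nf S a); rewrite !nf_prob_nf.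
Qed.

(** Residual steps need not be those chosen by [istep], so the induction hypothesis is used twice:
    at [c' b] it compares [istep] with the residual full step, and at [c a] it takes [istep] as the
    full step against the residual innermost one. *)
Lemma innermost_worst n t nu nu' : reachable t -> full S t nu ->
  innermost S t nu' -> expect (nf_prob n) nu' <= expect (nf_prob n) nu.
Proof.
elim: n t nu nu' => [|n IH] t nu nu' reach_t [l st] [l' [inn st']];
  have [/(expect_perm _)->//|] :=
    local_commute (reachable_spare reach_t st) inn st st';
  move=> [rho [rho' [c [c' [w [[rho_md rho'_md nuE nu'E] [full_w inn_w]]]]]]];
  rewrite nuE nu'E !expect_map.
  (* For [n = 0] the left side vanishes, since every [c' b] still admits the residual full step. *)
  apply: (@le_trans _ _ 0); last first.
    rewrite -(expect_cst 0 rho_md); apply: expect_le => // a _.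
    exact: nf_prob_ge0.
  rewrite -[leRHS](expect_cst 0 rho'_md); apply: expect_le => // b b_rho'.
  by rewrite /comp nf_prob0 //; apply: full_not_nf (full_w b b_rho').
have reach a : a \in Supp rho -> reachable (c a).
  move=> /mapP[q q_rho ->]; apply: reachable_step reach_t st _.
  by rewrite nuE; apply/mapP; exists (q.1, c q.2) => //; apply/mapP; exists q.
have reach' b : b \in Supp rho' -> reachable (c' b).
  move=> /mapP[q q_rho' ->]; apply: reachable_step reach_t st' _.
  by rewrite nu'E; apply/mapP; exists (q.1, c' q.2) => //; apply/mapP; exists q.
apply: (@le_trans _ _
  (expect (fun b => expect (fun a => nf_prob n (w a b)) rho) rho')).
  apply: expect_le => // b b_rho'; have st_b := full_w b b_rho'.
  have not_nf := full_not_nf st_b; rewrite /comp nf_probS //.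
  have := IH _ _ _ (reach' b b_rho') st_b (istepP not_nf).
  by rewrite (expect_map _ (w^~ b)).
rewrite expect_exchange; apply: expect_le => // a a_rho.
have [w_erase|st_a] := inn_w a a_rho.
  (* Erasure saves an innermost step; monotonicity in [n] absorbs the difference. *)
  apply: le_trans (nf_prob_leS n (c a)).
  rewrite -(expect_cst (nf_prob n (c a)) rho'_md).
  by apply: expect_le => // b b_rho'; rewrite w_erase.
have not_nf := full_not_nf (innermost_full st_a); rewrite /comp nf_probS //.
have := IH _ _ _ (reach a a_rho) (innermost_full (istepP not_nf)) st_a.
by rewrite expect_map.
Qed.

Lemma nf_massE mu : nf_mass S mu = expect (nf_prob 0) mu.
Proof.
rewrite /nf_mass /expect big_mkcond; apply: eq_bigr => q _ /=.
by case: ifP; rewrite ?mulr1 ?mulr0.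
Qed.

Lemma nf_prob_le_nf_mass t (mu : nat -> mdist R (term F V)) n :
  basic S t -> lift_seq (full S) t mu ->
  nf_prob n t <= nf_mass S (mu n).
Proof.
move=> t_basic [mu0 steps]; rewrite nf_massE.
have reach k : {in Supp (mu k), forall a, reachable a}.
  elim: k => [|k IH].
    by rewrite mu0 => a; rewrite inE => /eqP ->; apply: reachable_basic.
  apply: lifting_Supp (steps k) IH => a rho b reach_a [l st].
  exact: reachable_step reach_a st.
(* Hybrid argument: [k] full steps, then [m] innermost ones. Raising [k] trades one innermost step
   for a full one. *)
suff le_k k m : nf_prob (k + m) t <= expect (nf_prob m) (mu k).
  by rewrite -[n in nf_prob n]addn0; apply: le_k.
elim: k m => [|k IH] m; first by rewrite mu0 expect_dirac.
rewrite addSnnS; apply: le_trans (IH m.+1) _.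
apply: lifting_expect_le (steps k) (reach k) => [a nfa|a rho reach_a st].
  by rewrite !nf_prob_nf.
rewrite nf_probS; last exact: full_not_nf st.
exact: innermost_worst reach_a st (istepP (full_not_nf st)).
Qed.

Lemma innermost_seq_exists t : exists mu : nat -> mdist R (term F V),
  lift_seq (innermost S) t mu /\ forall n, nf_mass S (mu n) = nf_prob n t.
Proof.
pose kappa a := if `[< nf S a >] then [:: (1, a)] else istep a.
pose next mu : mdist R (term F V) :=
  flatten [seq scale q.1 (kappa q.2) | q <- mu].
pose mu n : mdist R (term F V) := iter n next [:: (1, t)].
have expect_next n nu : expect (nf_prob n) (next nu) = expect (nf_prob n.+1) nu.
  rewrite expect_flatten; apply: eq_bigr => q _; rewrite expect_scale /kappa /=.
  by case: asboolP => // nfq; rewrite expect_dirac nf_prob_nf.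
(* Labels are added so that [llifting_pointwise] applies; [unlabel lstep] is [innermost S] by
   definition. *)
pose lstep l s rho := innermost_redex S l /\ lfull S l s rho.
have /choice[ls lsP] a : exists ls : seq (redex R F V),
    llifting lstep ls [:: (1, a)] (kappa a).
  rewrite /kappa; case: asboolP => [nfa|/istepP[l st]].
    exists [::]; apply: llift_nf => -[rho /innermost_full st].
    by apply: nfa; exists rho.
  by exists [:: l]; apply: llift_step.
have mdist_mu n : is_mdist (mu n) /\ lifting (innermost S) (mu n) (mu n.+1).
  elim: n => [|n [_ st]].
    split; first exact: is_mdist_dirac.
    apply/(@lifting_unlabelP _ _ _ lstep); eexists.
    exact: llifting_pointwise (is_mdist_dirac _ _) lsP.
  have [|_ md] := lifting_mdist _ st.
    by move=> a rho /innermost_full/full_mdist.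
  split=> //; apply/(@lifting_unlabelP _ _ _ lstep); eexists.
  exact: llifting_pointwise md lsP.
exists mu; split; first by split=> // n; case: (mdist_mu n).
move=> n; rewrite nf_massE.
suff eq_k k m : expect (nf_prob m) (mu k) = nf_prob (k + m) t.
  by rewrite eq_k addn0.
elim: k m => [|k IH] m; first by rewrite expect_dirac.
by rewrite [mu _]/= expect_next IH addSnnS.
Qed.

End Spare.
End Orthogonal.

(** Only idle steps need an argument: a term without an innermost step is normal for full rewriting,
    by [innermost_exists]. *)
Lemma lift_seq_innermost_full t (mu : nat -> mdist R (term F V)) :
  lift_seq (innermost S) t mu -> lift_seq (full S) t mu.
Proof.
move=> [mu0 steps]; split=> // n; apply: lifting_sub (steps n) => [a rho|a nfa].
  exact: innermost_full.
by apply: contrapT => /innermost_exists[rho st]; apply: nfa; exists rho.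
Qed.

Lemma lift_seq_nf_mass_le1 t (mu : nat -> mdist R (term F V)) n :
  lift_seq (full S) t mu -> nf_mass S (mu n) <= 1.
Proof.
case=> _ /(_ n)/(lifting_mdist full_mdist)[[/allP pos sum1] _].
rewrite -sum1 /nf_mass big_mkcond /= big_seq [leRHS]big_seq.
by apply: ler_sum => q /pos/andP[q0 _]; case: ifP => // _; apply: ltW.
Qed.

End PTRS.
End Rewriting.

Theorem theorem5p11 (R : realType) (F : signature) (V : eqType)
    (V_infinite : infinite_set [set: V])
    (S : set (rule R F V)) (S_ptrs : is_ptrs S)
    (S_orthogonal : orthogonal_ptrs S) (S_spare : spare_ptrs S) :
  (fAST_on_basic S <-> iAST_on_basic S) /\
  (fPAST_on_basic S <-> iPAST_on_basic S).
Proof.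
have /choice[istep istepP] t : exists nu, ~ nf S t -> innermost S t nu.
  have [nft|/(innermost_exists S_ptrs)[nu st]] := pselect (nf S t).
    by exists [::].
  by exists nu.
split; split=> AST t mu t_basic seq_mu.
- exact: AST t mu t_basic (lift_seq_innermost_full S_ptrs seq_mu).
- have [nu [seq_nu nuE]] := innermost_seq_exists S_ptrs istepP t.
  (* The mass is squeezed between that of the fixed innermost sequence [nu] and 1. *)
  apply: (squeeze_cvgr (f := fun n => nf_mass S (nu n)) (h := fun=> 1)).
  + near=> n; rewrite nuE (nf_prob_le_nf_mass _ _ _ _ istepP) //.
    exact: lift_seq_nf_mass_le1 seq_mu.
  + exact: AST t nu t_basic seq_nu.
  + exact: cvg_cst.
- exact: AST t mu t_basic (lift_seq_innermost_full S_ptrs seq_mu).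
- have [nu [seq_nu nuE]] := innermost_seq_exists S_ptrs istepP t.
  (* The series of [nu] dominates termwise, as its normal form mass is the smaller one at every
     index. *)
  apply: le_lt_trans (AST t nu t_basic seq_nu).
  apply: lee_nneseries => [n _ _|n _]; rewrite lee_fin.
    by rewrite subr_ge0; apply: lift_seq_nf_mass_le1 seq_mu.
  by rewrite lerD2l lerN2 nuE (nf_prob_le_nf_mass _ _ _ _ istepP).
Unshelve. all: by end_near.
Qed.
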